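(* Let $H\in\mathbb{R}^{n\times n}$ be symmetric positive semidefinite, $c\in\mathbb{R}^n$, $A\in\mathbb{R}^{m\times n}$, $b\in\mathbb{R}^m$, $\beta>0$, and let $n=p\,s$ with positive integers $p,s$. Assume that the problem $$\min_{x\in\mathbb{R}^n}\ \tfrac12 x^THx+c^Tx\quad\text{s.t. } Ax=b$$ has at least one KKT point, and that for every index block $\omega\subseteq\{1,\dots,n\}$ with $|\omega|=s$ one has $H_{\omega,\omega}+\beta A_\omega^TA_\omega\succ 0$. Let $z^k=(x^k;y^k)$, $k\ge 0$, be the random sequence generated by RAC-ADMM with $p$ blocks of size $s$ and penalty parameter $\beta$ (as defined in the context), started from an arbitrary deterministic $z^0\in\mathbb{R}^{n+m}$. Then the expected output $\mathbb{E}(z^k)$ converges, as $k\to\infty$, to some KKT point of the problem.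
   Context: For an index block $\omega$, $A_\omega$ is the submatrix of $A$ formed by the columns indexed by $\omega$, and $H_{\omega,\omega'}$ is the submatrix of $H$ with rows in $\omega$ and columns in $\omega'$. A KKT point of the problem is a pair $(x,y)\in\mathbb{R}^n\times\mathbb{R}^m$ with $Hx+c-A^Ty=0$ and $Ax=b$. Augmented Lagrangian: $L_\beta(x,y)=\tfrac12x^THx+c^Tx-y^T(Ax-b)+\tfrac{\beta}{2}\|Ax-b\|^2$. Updating orders: $\Gamma_{RAC(n,p)}$ is the set of all ordered partitions $\sigma=(\sigma_1,\dots,\sigma_p)$ of $\{1,\dots,n\}$ into $p$ blocks of size $s$ each; $|\Gamma_{RAC(n,p)}|=n!/(s!)^p$. RAC-ADMM (randomly assembled cyclic ADMM): at each iteration $k$, draw $\sigma\in\Gamma_{RAC(n,p)}$ uniformly at random, independently of the previous iterations. Then, for $i=1,\dots,p$ successively, update block $\sigma_i$ by setting $x_{\sigma_i}^{k+1}$ to be the minimizer over $x_{\sigma_i}\in\mathbb{R}^s$ of $L_\beta(\cdot\,;y^k)$, where the blocks $\sigma_1,\dots,\sigma_{i-1}$ are fixed at their new values $x^{k+1}$ and the blocks $\sigma_{i+1},\dots,\sigma_p$ at their old values $x^k$. Finally set $y^{k+1}=y^k-\beta(Ax^{k+1}-b)$. The positive definiteness hypothesis makes each block minimizer unique. The expectation is over the random draws of $\sigma$. *)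

(* Defs.v *)
From mathcomp Require Import all_boot all_order all_algebra.
From mathcomp Require Import all_classical all_reals all_analysis.

Set Implicit Arguments.
Unset Strict Implicit.
Unset Printing Implicit Defensive.

Import Order.TTheory GRing.Theory Num.Theory.
Import numFieldNormedType.Exports.

Local Open Scope ring_scope.

Section LinearAlgebra.
Context {R : realType}.

(* The Euclidean inner product: the norm that the library puts on matrices is
   the sup norm, so squared Euclidean norms are written [dotv v v]. *)
Definition dotv n (u v : 'cV[R]_n) : R := (u^T *m v) 0 0.

Definition psd_mx n (M : 'M[R]_n) : Prop :=
  M^T = M /\ forall v : 'cV[R]_n, 0 <= dotv v (M *m v).

Definition pd_mx n (M : 'M[R]_n) : Prop :=
  M^T = M /\ forall v : 'cV[R]_n, v != 0 -> 0 < dotv v (M *m v).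

Definition colblock m n (A : 'M[R]_(m, n)) (w : {set 'I_n}) : 'M[R]_(m, #|w|) :=
  colsub (enum_val (A := mem w)) A.

Definition subblock n (H : 'M[R]_n) (w w' : {set 'I_n}) : 'M[R]_(#|w|, #|w'|) :=
  mxsub (enum_val (A := mem w)) (enum_val (A := mem w')) H.

End LinearAlgebra.

Definition Gamma_RAC (n p s : nat) : {set {ffun 'I_p -> {set 'I_n}}} :=
  [set sigma : {ffun 'I_p -> {set 'I_n}} |
    [&& [forall i, #|sigma i| == s],
        [forall i, forall j, (i != j) ==> [disjoint sigma i & sigma j]] &
        [forall l, exists i, l \in sigma i]]].

Section Problem.
Context {R : realType} (m n : nat).
Variables (H : 'M[R]_n) (c : 'cV[R]_n) (A : 'M[R]_(m, n)) (b : 'cV[R]_m).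

Definition is_KKT (x : 'cV[R]_n) (y : 'cV[R]_m) : Prop :=
  H *m x + c - A^T *m y = 0 /\ A *m x = b.

Variable beta : R.

Definition aug_lagrangian (x : 'cV[R]_n) (y : 'cV[R]_m) : R :=
  2^-1 * dotv x (H *m x) + dotv c x - dotv y (A *m x - b)
  + beta / 2 * dotv (A *m x - b) (A *m x - b).

Variable p : nat.

(* The vector with the entries of [x'] on the blocks [sigma 0, ..., sigma i]
   and the entries of [x] on the later blocks. *)
Definition sweep (sigma : {ffun 'I_p -> {set 'I_n}}) (x x' : 'cV[R]_n)
    (i : 'I_p) : 'cV[R]_n :=
  \col_l (if [exists j : 'I_p, (j <= i)%N && (l \in sigma j)]
          then x' l 0 else x l 0).

(* One iteration from [(x, y)] to [(x', y')] with updating order [sigma]: for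
   each [i], among all vectors that differ from the current sweep only on the
   block [sigma i], the current sweep minimizes the augmented Lagrangian. *)
Definition rac_admm_step (sigma : {ffun 'I_p -> {set 'I_n}})
    (x : 'cV[R]_n) (y : 'cV[R]_m) (x' : 'cV[R]_n) (y' : 'cV[R]_m) : Prop :=
  (forall (i : 'I_p) (u : 'cV[R]_n),
     (forall l, l \notin sigma i -> u l 0 = sweep sigma x x' i l 0) ->
     aug_lagrangian (sweep sigma x x' i) y <= aug_lagrangian u y) /\
  y' = y - beta *: (A *m x' - b).

End Problem.

Section Randomness.
Context {d : measure_display} {T : measurableType d} {R : realType}.
Variable P : probability T R.

Definition mutually_independent (G : Type) (X : nat -> T -> G) : Prop :=
  forall (J : seq nat) (B : nat -> set G), uniq J ->
    P (\bigcap_(k in [set` J]) (X k @^-1` B k))%classic =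
    (\prod_(k <- J) P (X k @^-1` B k)%classic)%E.

Definition iid_uniform (G : finType) (S : {set G}) (X : nat -> T -> G) : Prop :=
  [/\ forall k w, X k w \in S,
      forall k g, measurable (X k @^-1` [set g])%classic,
      forall k g, g \in S ->
        P (X k @^-1` [set g])%classic = ((#|S|%:R)^-1)%:E &
      mutually_independent X].

(* [fine] only moves the expectation from [\bar R] to [R]; it loses nothing for
   vectors taking finitely many values. *)
Definition expectation_vec q (Z : T -> 'cV[R]_q) : 'cV[R]_q :=
  \col_i fine 'E_P[fun w => Z w i 0].

End Randomness.

Definition is_rac_admm {R : realType} {T : Type} (m n p : nat)
    (H : 'M[R]_n) (c : 'cV[R]_n) (A : 'M[R]_(m, n)) (b : 'cV[R]_m) (beta : R)
    (x0 : 'cV[R]_n) (y0 : 'cV[R]_m)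
    (sigma : nat -> T -> {ffun 'I_p -> {set 'I_n}})
    (x : nat -> T -> 'cV[R]_n) (y : nat -> T -> 'cV[R]_m) : Prop :=
  (forall w, x 0%N w = x0 /\ y 0%N w = y0) /\
  forall k w, rac_admm_step H c A b beta (sigma k w)
    (x k w) (y k w) (x k.+1 w) (y k.+1 w).

(* Main.v *)
Require Import Defs.
From mathcomp Require Import all_boot all_order all_algebra.
From mathcomp Require Import all_classical all_reals all_analysis.
From mathcomp Require Import ring lra complex.
Import Order.TTheory GRing.Theory Num.Theory.
Import numFieldNormedType.Exports.
Local Open Scope classical_set_scope.
Local Open Scope ring_scope.

Set Implicit Arguments.
Unset Strict Implicit.
Unset Printing Implicit Defensive.

(* Relative to a KKT point the error (xi, eta) evolves linearly, xi' = xi - Q (S xi - A^T eta) and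
   eta' = eta - beta A xi', with S = H + beta A^T A and Q depending only on the updating order. By
   independence the expected error evolves in the same way, with Q replaced by its average over the
   orders. The average Q is symmetric positive definite and satisfies Q^-1 > (3/4) S; both facts
   follow by induction on the number of blocks, conditioning on the first or last block. Then every
   eigenvalue of the expected iteration other than 1 has modulus less than 1, the eigenvalue 1 is
   semisimple, and its eigenvectors are the differences of KKT points, so the powers converge. *)

(** * The Euclidean inner product and the averaged sweep *)

(** The constant [4 / 3] arises twice. Let [w], [h], [a] be the values at [xi] of the forms of
    [Q^-1], [H] and [beta A^T A]. An eigenvalue [-1] forces [4 w = 2 h + 3 a], which
    [w > 3/4 (h + a)] rules out, sharply when [h = 0]. Independently, completing the square shows
    that one more block preserves a bound [S Q S <= c S] as soon as [1 - 3 c / 4 <= 0]. Nonreal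
    eigenvalues need no such constant: they satisfy [|z|^2 = 1 - (h + a) / w] with [h + a > 0]. Two
    obstacles shape the argument. The [Q] of a single order need not be symmetric; reversing the
    order transposes it, so the average over all orders is symmetric. And [S] may be singular, so
    the bound travels through the induction as [S Q S] against [S], and becomes one on [Q^-1] only
    once [Q] is known to be definite. *)

Section Dot.
Context {R : realType}.

Lemma dotvE n (u v : 'cV[R]_n) : dotv u v = \sum_i u i 0 * v i 0.
Proof. by rewrite /dotv mxE; apply: eq_bigr => i _; rewrite mxE. Qed.

Lemma dotvC n (u v : 'cV[R]_n) : dotv u v = dotv v u.
Proof. by rewrite !dotvE; apply: eq_bigr => i _; rewrite mulrC. Qed.

Lemma dotvDr n (u v w : 'cV[R]_n) : dotv u (v + w) = dotv u v + dotv u w.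
Proof. by rewrite /dotv mulmxDr mxE. Qed.

Lemma dotvDl n (u v w : 'cV[R]_n) : dotv (v + w) u = dotv v u + dotv w u.
Proof. by rewrite !(dotvC _ u) dotvDr. Qed.

Lemma dotvNr n (u v : 'cV[R]_n) : dotv u (- v) = - dotv u v.
Proof. by rewrite /dotv mulmxN mxE. Qed.

Lemma dotvNl n (u v : 'cV[R]_n) : dotv (- v) u = - dotv v u.
Proof. by rewrite !(dotvC _ u) dotvNr. Qed.

Lemma dotvZr n a (u v : 'cV[R]_n) : dotv u (a *: v) = a * dotv u v.
Proof. by rewrite /dotv -scalemxAr mxE. Qed.

Lemma dotvZl n a (u v : 'cV[R]_n) : dotv (a *: v) u = a * dotv v u.
Proof. by rewrite !(dotvC _ u) dotvZr. Qed.

Lemma dotv0r n (u : 'cV[R]_n) : dotv u 0 = 0.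
Proof. by rewrite /dotv mulmx0 mxE. Qed.

Lemma dotv_sumr n (I : Type) (r : seq I) (P : pred I) (F : I -> 'cV[R]_n) u :
  dotv u (\sum_(i <- r | P i) F i) = \sum_(i <- r | P i) dotv u (F i).
Proof. by rewrite /dotv mulmx_sumr summxE. Qed.

Lemma dotv_mulmxl m n (M : 'M[R]_(m, n)) u v : dotv (M *m u) v = dotv u (M^T *m v).
Proof. by rewrite /dotv trmx_mul mulmxA. Qed.

Lemma dotv_ge0 n (u : 'cV[R]_n) : 0 <= dotv u u.
Proof. by rewrite dotvE sumr_ge0 // => i _; rewrite -expr2 sqr_ge0. Qed.

Lemma dotv_eq0 n (u : 'cV[R]_n) : dotv u u = 0 -> u = 0.
Proof.
rewrite dotvE => /psumr_eq0P u0; apply/colP => i; rewrite !mxE; apply/eqP.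
by rewrite -sqrf_eq0 expr2 u0 // => j _; rewrite -expr2 sqr_ge0.
Qed.

Definition dotvL := (dotvDl, dotvDr, dotvNl, dotvNr, dotvZl, dotvZr).

End Dot.

Section AverageSweep.
Context {R : realType} (n s : nat).
Variables (S : 'M[R]_n) (B : {set 'I_n} -> 'M[R]_n).

Definition isblock (U w : {set 'I_n}) := (w \subset U) && (#|w| == s).

Fixpoint Gcount (k : nat) (U : {set 'I_n}) : nat :=
  if k is k'.+1 then (\sum_(w | isblock U w) Gcount k' (U :\: w))%N
  else (U == finset.set0).

(* A block update is [x := x - B w (S x - r)], so a whole sweep is [x := x - Q (S x - r)],
   and appending the block [w] turns [Q] into [Q + B w - B w S Q]. [Gsum k U] sums these [Q]
   over the ordered partitions of [U] into [k] blocks of size [s]; [Gcount k U] is their number. *)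
Fixpoint Gsum (k : nat) (U : {set 'I_n}) : 'M[R]_n :=
  if k is k'.+1 then
    \sum_(w | isblock U w)
      (Gsum k' (U :\: w) + (Gcount k' (U :\: w))%:R *: B w
       - B w *m S *m Gsum k' (U :\: w))
  else 0.

Hypothesis psdS : psd_mx S.
Hypothesis trB : forall w : {set 'I_n}, #|w| = s -> (B w)^T = B w.
Hypothesis BSB : forall w : {set 'I_n}, #|w| = s -> B w *m S *m B w = B w.
Hypothesis B_eq0 : forall (w : {set 'I_n}) r, #|w| = s -> dotv r (B w *m r) = 0 ->
  B w *m r = 0 /\ forall l, l \in w -> r l 0 = 0.

Let q k U u v := dotv u (Gsum k U *m v).

Lemma dotv_symS u v : dotv (S *m u) v = dotv u (S *m v).
Proof. by rewrite dotv_mulmxl psdS.1. Qed.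

Lemma dotv_symB (w : {set 'I_n}) u v : #|w| = s -> dotv (B w *m u) v = dotv u (B w *m v).
Proof. by move=> ws; rewrite dotv_mulmxl trB. Qed.

Lemma qform_rec k U u v : q k.+1 U u v =
  \sum_(w | isblock U w) (q k (U :\: w) u v
     + (Gcount k (U :\: w))%:R * dotv u (B w *m v)
     - q k (U :\: w) (S *m (B w *m u)) v).
Proof.
rewrite /q /= mulmx_suml dotv_sumr; apply: eq_bigr => w /andP[_ /eqP ws].
rewrite mulmxBl mulmxDl -scalemxAl !dotvL; congr (_ - _).
by rewrite -!mulmxA -(dotv_symB _ _ ws) -dotv_symS.
Qed.

Lemma isblock_exchange U w w' :
  isblock U w && isblock (U :\: w) w' = isblock U w' && isblock (U :\: w') w.
Proof.
rewrite /isblock !subsetD (disjoint_sym w').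
by case: (w \subset U); case: (w' \subset U); case: (#|w| == s); case: (#|w'| == s);
  rewrite ?andbF ?andbT.
Qed.

(** [qform_rec] removes the block updated last; here the block updated first is removed. Peeling
    each side once more at its other end gives sums over the pair of extreme blocks ([w] last, [w']
    first), which are then exchanged. *)
Lemma qform_rec_last k U u v : q k.+1 U u v =
  \sum_(w | isblock U w) (q k (U :\: w) u v
     + (Gcount k (U :\: w))%:R * dotv u (B w *m v)
     - q k (U :\: w) u (S *m (B w *m v))).
Proof.
elim: k U u v => [|k IH] U u v.
  rewrite qform_rec; apply: eq_bigr => w _; congr (_ - _).
  by rewrite /q /= !mul0mx !dotv0r.
pose f w w' (V := U :\: w :\: w') := q k V u v
  + (Gcount k V)%:R * dotv u (B w' *m v) - q k V u (S *m (B w' *m v))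
  + (Gcount k V)%:R * dotv u (B w *m v) - q k V (S *m (B w *m u)) v
  - (Gcount k V)%:R * dotv (S *m (B w *m u)) (B w' *m v)
  + q k V (S *m (B w *m u)) (S *m (B w' *m v)).
transitivity (\sum_(w | isblock U w) \sum_(w' | isblock (U :\: w) w') f w w').
  rewrite qform_rec; apply: eq_bigr => w _; rewrite !IH /=.
  rewrite natr_sum mulr_suml -big_split /= -sumrB; apply: eq_bigr => w' _.
  by rewrite /f; ring.
rewrite (exchange_big_dep (isblock U)) /=; last first.
  by move=> w w' /andP[wU ws] /andP[]; rewrite subsetD => /andP[w'U _] w's; apply/andP.
apply: eq_bigr => w' /andP[w'U w's]; rewrite !qform_rec /=.
rewrite natr_sum mulr_suml -big_split /= -sumrB.
rewrite (eq_bigl (isblock (U :\: w'))) /=; last first.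
  by move=> w; rewrite isblock_exchange /isblock w'U w's.
apply: eq_bigr => w /andP[_ /eqP ws]; rewrite /f /=.
have -> : U :\: w :\: w' = U :\: w' :\: w by rewrite !finset.setDDl finset.setUC.
have -> : dotv (S *m (B w *m u)) (B w' *m v) = dotv u (B w *m (S *m (B w' *m v))).
  by rewrite dotv_symS dotv_symB.
by ring.
Qed.

(** Removing the last block on one side and the first on the other makes the summands match:
    reversing an order transposes its matrix. *)
Lemma qform_sym k U u v : q k U u v = q k U v u.
Proof.
elim: k U u v => [|k IH] U u v; first by rewrite /q /= !mul0mx !dotv0r.
rewrite qform_rec qform_rec_last; apply: eq_bigr => w /andP[_ /eqP ws].
by rewrite IH (IH _ (S *m _)) -(dotv_symB _ _ ws) (dotvC _ v).
Qed.

Lemma Gsum_sym k U : (Gsum k U)^T = Gsum k U.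
Proof.
apply/matrixP => i j; rewrite mxE.
have := qform_sym k U (delta_mx j 0) (delta_mx i 0); rewrite /q !dotvE.
have pick l (f : 'cV[R]_n) : \sum_i0 (delta_mx l 0 : 'cV[R]_n) i0 0 * f i0 0 = f l 0.
  rewrite (bigD1 l) //= mxE !eqxx mul1r big1 ?addr0 // => i0 /negPf i0l.
  by rewrite mxE i0l mul0r.
by rewrite !pick -!colE !mxE.
Qed.

(* Completing the square makes [4 / 3] the fixed point of the recursion for the bound on [S Q S]. *)
Lemma qform_square k U w r (y := S *m (B w *m r)) :
  q k U r r - q k U y r =
  q k U (r - 2^-1 *: y) (r - 2^-1 *: y) - 4^-1 * q k U y y.
Proof.
rewrite /q !(mulmxDr, mulmxN) -!scalemxAr !dotvL -!/(q k U _ _).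
by rewrite (qform_sym _ _ r y); field.
Qed.

Lemma blockformE (w : {set 'I_n}) r : #|w| = s ->
  dotv (B w *m r) (S *m (B w *m r)) = dotv r (B w *m r).
Proof. by move=> ws; rewrite dotv_symB // !mulmxA BSB. Qed.

Lemma blockform_ge0 (w : {set 'I_n}) r : #|w| = s -> 0 <= dotv r (B w *m r).
Proof. by move=> ws; rewrite -blockformE //; exact: psdS.2. Qed.

Let qle k U := forall v,
  q k U (S *m v) (S *m v) <= 4 / 3 * (Gcount k U)%:R * dotv v (S *m v).

(** The negative square costs at most a quarter of [4 / 3] times the block form, so
    [1 - 1 / 3 = 2 / 3] of that form survives. *)
Lemma qterm_ge k U (w : {set 'I_n}) r (y := S *m (B w *m r)) : #|w| = s -> qle k U ->
  q k U (r - 2^-1 *: y) (r - 2^-1 *: y) + 2 / 3 * ((Gcount k U)%:R * dotv r (B w *m r))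
  <= q k U r r + (Gcount k U)%:R * dotv r (B w *m r) - q k U y r.
Proof.
move=> ws /(_ (B w *m r)); rewrite addrAC qform_square blockformE // -/y.
lra.
Qed.

(** [t = B w S v] is the [S]-orthogonal projection of [v] onto the range of [B w], and [u] removes
    half of it. The [S]-form drops by [3 / 4] of that of [t], which times [4 / 3] pays exactly for
    the new block. The factor [4^-1] keeps the form of [u] positive, as the strict bound
    requires. *)
Lemma qterm_le k U (w : {set 'I_n}) v (r := S *m v) (y := S *m (B w *m r)) :
  #|w| = s -> (forall r, 0 <= q k U r r) ->
  exists u, [/\ 4^-1 * dotv v (S *m v) <= dotv u (S *m u) &
    q k U r r + (Gcount k U)%:R * dotv r (B w *m r) - q k U y r
    <= q k U (S *m u) (S *m u)
       + 4 / 3 * (Gcount k U)%:R * (dotv v (S *m v) - dotv u (S *m u))].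
Proof.
move=> ws q0; pose t := B w *m r; pose u := v - 2^-1 *: t.
have tSt : dotv t (S *m t) = dotv r (B w *m r) by exact: blockformE.
have vSt : dotv v (S *m t) = dotv r (B w *m r) by rewrite -dotv_symS.
have tSv : dotv t (S *m v) = dotv r (B w *m r) by rewrite dotvC.
have uSu : dotv u (S *m u) = dotv v (S *m v) - 3 / 4 * dotv r (B w *m r).
  by rewrite /u mulmxBr -scalemxAr !dotvL tSt vSt tSv; field.
have rle : dotv r (B w *m r) <= dotv v (S *m v).
  have := psdS.2 (v - t); rewrite mulmxBr !dotvL tSt vSt tSv; lra.
exists u; split; first by rewrite uSu; lra.
rewrite addrAC qform_square uSu /u mulmxBr -scalemxAr -/r.
have := q0 y; rewrite /y /t; lra.
Qed.

(** The bounds need a joint induction: nonnegativity with one more block uses the upper bound for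
    the remaining blocks, and the upper bound uses nonnegativity. *)
Lemma Gsum_bounds k U : (forall r, 0 <= q k U r r) /\ qle k U.
Proof.
elim: k U => [|k IH] U.
  split=> [r|v]; rewrite /q /= mul0mx dotv0r //.
  by rewrite !mulr_ge0 ?psdS.2 ?invr_ge0.
split=> [r|v].
  rewrite qform_rec; apply: sumr_ge0 => w /andP[_ /eqP ws].
  have [ge0 le43] := IH (U :\: w).
  apply: le_trans (qterm_ge _ ws le43).
  by rewrite addr_ge0 ?mulr_ge0 ?blockform_ge0.
rewrite qform_rec /= natr_sum mulr_sumr mulr_suml.
apply: ler_sum => w /andP[_ /eqP ws].
have [ge0 le43] := IH (U :\: w).
have [u [_ /le_trans]] := qterm_le v ws ge0; apply.
have := le43 u; lra.
Qed.

(** One block [w] that extends to a partition suffices. Its summand vanishes, so [B w *m r = 0] and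
    [r] is zero on [w]; the shifted vector in the square is then [r] itself, and induction covers
    [U :\: w]. *)
Lemma Gsum_eq0 k U r : (0 < Gcount k U)%N -> q k U r r = 0 ->
  forall l, l \in U -> r l 0 = 0.
Proof.
elim: k U r => [|k IH] U r /=.
  by rewrite lt0b => /eqP -> _ l; rewrite finset.inE.
rewrite lt0n sum_nat_eq0 negb_forall => /existsP[w]; rewrite negb_imply -lt0n.
move=> /andP[Uw N0]; have /andP[wU /eqP ws] := Uw.
rewrite qform_rec => /psumr_eq0P q0.
have [ge0 le43] := Gsum_bounds k (U :\: w).
have := qterm_ge r ws le43; rewrite q0 //; last first.
  move=> w' /andP[_ /eqP w's]; have [ge0' le43'] := Gsum_bounds k (U :\: w').
  by apply: le_trans (qterm_ge _ w's le43'); rewrite addr_ge0 ?mulr_ge0 ?blockform_ge0.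
have b0 := blockform_ge0 r ws.
have Nb : dotv r (B w *m r) <= (Gcount k (U :\: w))%:R * dotv r (B w *m r).
  by rewrite ler_peMl // ler1n.
set qr := q k _ _ _ => le0; have qr0 : 0 <= qr by exact: ge0.
have qr00 : qr = 0 by apply/eqP; rewrite eq_le qr0 andbT; lra.
have br0 : dotv r (B w *m r) = 0 by apply/eqP; rewrite eq_le b0 andbT; lra.
have [Br rw] := B_eq0 ws br0.
move: qr00; rewrite /qr Br mulmx0 scaler0 subr0 => /(IH _ _ N0) rUw l lU.
have [lw|lw] := boolP (l \in w); first exact: rw.
by apply: rUw; rewrite finset.inE lw.
Qed.

(** Strictness starts at the empty sweep, whose form is zero. With one more block, equality would
    make every summand tight, but a [w] with nonzero count yields a [u] of positive [S]-form, to
    which induction applies. *)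
Lemma Gsum_lt43 k U v : (0 < Gcount k U)%N -> 0 < dotv v (S *m v) ->
  q k U (S *m v) (S *m v) < 4 / 3 * (Gcount k U)%:R * dotv v (S *m v).
Proof.
elim: k U v => [|k IH] U v.
  by move=> N0 v0; rewrite {1}/q mul0mx dotv0r !mulr_gt0 ?ltr0n.
move=> /= N0 v0; rewrite qform_rec natr_sum mulr_sumr mulr_suml -subr_gt0 -sumrB.
have le43 w : isblock U w -> 0 <=
    4 / 3 * (Gcount k (U :\: w))%:R * dotv v (S *m v)
    - (q k (U :\: w) (S *m v) (S *m v)
     + (Gcount k (U :\: w))%:R * dotv (S *m v) (B w *m (S *m v))
     - q k (U :\: w) (S *m (B w *m (S *m v))) (S *m v)).
  move=> /andP[_ /eqP ws].
  have [ge0 le43] := Gsum_bounds k (U :\: w).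
  have [u [_]] := qterm_le v ws ge0.
  have := le43 u; lra.
rewrite lt_def sumr_ge0 // andbT; apply: contraL N0 => /eqP/psumr_eq0P s0.
rewrite -leqNgt leqn0 sum_nat_eq0; apply/forallP => w; apply/implyP => Uw.
have := s0 le43 w Uw; have /andP[_ /eqP ws] := Uw.
have [u [vu]] := qterm_le v ws (Gsum_bounds k (U :\: w)).1.
move=> le1 s00; rewrite -leqn0 leqNgt; apply/negP => N0.
have u0 : 0 < dotv u (S *m u) by apply: lt_le_trans vu; rewrite mulr_gt0 ?invr_gt0.
have := IH _ _ N0 u0; lra.
Qed.

End AverageSweep.

(** * Convergence of matrix powers *)

Section Powers.
Context {R : realType}.

Lemma contraction_cvg0 (rho : R) (a e : R^nat) :
  0 <= rho < 1 -> (forall k, 0 <= a k) ->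
  (forall k, a k.+1 <= rho * a k + e k) ->
  e @ \oo --> 0 -> a @ \oo --> 0.
Proof.
move=> /andP[r0 r1] a0 arec /cvgr0Pnorm_le ecv.
apply/cvgr0Pnorm_le => eps eps0.
(* With this error level, [eps / 2] is the fixed point of the recursion. *)
have d0 : 0 < eps / 2 * (1 - rho) by rewrite mulr_gt0 ?divr_gt0 ?subr_gt0.
have [K _ Kbd] := ecv _ d0.
have bd j : a (K + j)%N <= rho ^+ j * a K + eps / 2.
  elim: j => [|j IH]; first by rewrite addn0 expr0 mul1r lerDl divr_ge0 ?ltW.
  rewrite addnS; apply: le_trans (arec _) _.
  have ek : e (K + j)%N <= eps / 2 * (1 - rho).
    by apply: le_trans (ler_norm _) _; apply: Kbd; rewrite /= leq_addr.
  have := ler_wpM2l r0 IH; rewrite exprS => IH'.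
  by apply: le_trans (lerD IH' ek) _; rewrite le_eqVlt; apply/orP; left; apply/eqP; field.
have /cvgr0Pnorm_le rcv : (fun j => rho ^+ j * a K) @ \oo --> 0.
  rewrite -[0](mul0r (a K)); apply: cvgMr_tmp.
  by apply: cvg_expr; rewrite ger0_norm.
have e2 : 0 < eps / 2 by rewrite divr_gt0.
have [J _ Jbd] := rcv _ e2.
exists (K + J)%N => // k /= KJk.
have Kk : (K <= k)%N by apply: leq_trans KJk; rewrite leq_addr.
rewrite ger0_norm // -(subnKC Kk).
apply: le_trans (bd _) _.
have := Jbd (k - K)%N; rewrite /= leq_subRL // => /(_ KJk).
by move=> /(le_trans (ler_norm _)); lra.
Qed.


Import ComplexField.Normc.

Lemma Re_le_normc (z : R[i]) : `|complex.Re z| <= normc z.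
Proof.
case: z => a b /=; rewrite -(@ler_pXn2r _ 2) ?nnegrE ?sqrtr_ge0 //.
by rewrite sqr_sqrtr ?addr_ge0 ?sqr_ge0 // real_normK ?num_real // lerDl sqr_ge0.
Qed.

(* If [v' = (M - z) v] then [M^(k+1) v = z M^k v + M^k v']: one root at a time. *)
Lemma prod_powers_cvg0 N (M : 'M[R[i]]_N.+1) (rs : seq R[i]) (v : 'cV[R[i]]_N.+1) :
  (forall z, z \in rs -> normc z < 1) ->
  (\prod_(z <- rs) (M - z%:M)) *m v = 0 ->
  forall i, (fun k => normc ((M ^+ k *m v) i 0)) @ \oo --> (0 : R).
Proof.
elim/last_ind: rs v => [|rs z IH] v rs1 pv i.
  move: pv; rewrite big_nil mul1mx => ->.
  by under eq_fun do rewrite mulmx0 mxE normc0; exact: cvg_cst.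
have z1 : normc z < 1 by apply: rs1; rewrite mem_rcons inE eqxx.
pose v' := (M - z%:M) *m v.
have pv' : (\prod_(z <- rs) (M - z%:M)) *m v' = 0.
  by rewrite mulmxA -pv -cats1 big_cat big_seq1.
have {}IH := IH v' _ pv' i.
apply: (@contraction_cvg0 (normc z)); last first.
- by apply: IH => y yrs; apply: rs1; rewrite mem_rcons inE yrs orbT.
- move=> k; have -> : M ^+ k.+1 *m v = z *: (M ^+ k *m v) + M ^+ k *m v'.
    rewrite /v' mulmxBl mul_scalar_mx mulmxBr -scalemxAr addrC subrK.
    by rewrite exprSr -mulmxA.
  by rewrite mxE; apply: le_trans (le_normcD _ _) _; rewrite mxE normcM.
- by move=> k; case: (_ i 0) => a b /=; exact: sqrtr_ge0.
- by rewrite z1 andbT; case: (z) => a b /=; exact: sqrtr_ge0.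
Qed.

(* Cayley-Hamilton and semisimplicity of 1 give [(M - 1) q(M) = 0] with [q(1) != 0], where the roots
   of [q] lie in the open disc; the limit of [M^k v] is then [q(M) v / q(1)]. *)
Lemma complex_powers_cvg N (M : 'M[R[i]]_N.+1) :
  (forall (z : R[i]) (v : 'cV[R[i]]_N.+1),
     v != 0 -> M *m v = z *: v -> z = 1 \/ normc z < 1) ->
  (forall v : 'cV[R[i]]_N.+1,
     (M - 1) *m ((M - 1) *m v) = 0 -> (M - 1) *m v = 0) ->
  forall v : 'cV[R[i]]_N.+1, exists2 l : 'cV[R[i]]_N.+1, M *m l = l &
    forall i, (fun k => normc ((M ^+ k *m v) i 0 - l i 0)) @ \oo --> (0 : R).
Proof.
move=> eigM kerM v.
have [r chiE] := closed_field_poly_normal (char_poly M).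
move: chiE; rewrite (monicP (char_poly_monic M)) scale1r => chiE.
pose rs := [seq z <- r | z != 1].
pose q : {poly R[i]} := \prod_(z <- rs) ('X - z%:P).
have rs1 z : z \in rs -> normc z < 1.
  rewrite mem_filter => /andP[z1 zr].
  have : root (char_poly M) z by rewrite chiE root_prod_XsubC.
  rewrite -eigenvalue_root_char => ez.
  (* [eigenvalue] concerns row vectors; transposing yields the column eigenvector that [eigM]
     expects. *)
  have : eigenvalue M^T z.
    move: ez; rewrite !eigenvalue_root_char /char_poly -det_tr.
    by rewrite /char_poly_mx linearB /= tr_scalar_mx map_trmx.
  case/eigenvalueP => u uM u0.
  have [] // := eigM z u^T.
  - by rewrite -(inj_eq trmx_inj) trmxK trmx0.
  - by rewrite -[M]trmxK -trmx_mul uM linearZ.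
  - by move=> z1E; rewrite z1E eqxx in z1.
have qM : horner_mx M q = \prod_(z <- rs) (M - z%:M).
  rewrite rmorph_prod; apply: eq_bigr => z _.
  by rewrite rmorphB /= horner_mx_X horner_mx_C.
have q1 : q.[1] != 0.
  rewrite -[_ == 0]/(root q 1) root_prod_XsubC mem_filter eqxx //.
have [j chiq] : exists j, char_poly M = ('X - 1%:P) ^+ j * q.
  exists (count (pred1 1) r).
  rewrite chiE (bigID (pred1 1)) /= /q big_filter; congr (_ * _).
  by rewrite (eq_bigr (fun=> 'X - 1%:P)) ?big_const_seq ?iter_mulr_1 // => z /eqP->.
have M1q (w : 'cV_N.+1) : (M - 1) *m (horner_mx M q *m w) = 0.
  have kerj i (u : 'cV_N.+1) : (M - 1) ^+ i *m u = 0 -> (M - 1) *m u = 0.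
    elim: i u => [|i IH] u; first by rewrite expr0 mul1mx => ->; rewrite mulmx0.
    by rewrite exprSr -mulmxA => /IH; exact: kerM.
  apply: (kerj j); have /(congr1 (mulmx^~ w)) := Cayley_Hamilton M.
  rewrite chiq rmorphM rmorphXn rmorphB /= horner_mx_X horner_mx_C mul0mx.
  by rewrite -mulmxA.
(* Dividing [q - q.[1]] by [X - 1] splits [v] into the fixed part [l] and a part [w] in the range of
   [M - 1], which [q(M)] kills. *)
have : root (q - q.[1]%:P) 1 by rewrite /root !hornerE subrr.
case/factor_theorem => t /(canRL (subrK _)) qE.
pose w := - (q.[1]^-1 *: ((M - 1) *m (horner_mx M t *m v))).
pose l := q.[1]^-1 *: (horner_mx M q *m v).
have Ml : M *m l = l.
  apply/eqP; rewrite -subr_eq0 -{2}[l]mul1mx -mulmxBl /l -scalemxAr.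
  by rewrite M1q scaler0.
have vE : v = l + w.
  rewrite /l /w -scalerBr.
  have -> : horner_mx M q *m v = (M - 1) *m (horner_mx M t *m v) + q.[1] *: v.
    rewrite [in LHS]qE rmorphD /= mulrC rmorphM rmorphB /= horner_mx_X !horner_mx_C.
    by rewrite mulmxDl -mulmxA mul_scalar_mx.
  by rewrite addrC addrA addNr add0r scalerA mulVf // scale1r.
have Mkl k : M ^+ k *m l = l.
  by elim: k => [|k IH]; rewrite ?mul1mx // exprSr -mulmxA Ml.
exists l => // i.
under eq_fun do rewrite {1}vE mulmxDr mxE Mkl addrAC subrr add0r.
apply: (@prod_powers_cvg0 _ _ rs) => //.
rewrite -qM /w mulmxN -scalemxAr [X in _ *: X](_ : _ = 0) ?scaler0 ?oppr0 //.
have comm : horner_mx M q *m (M - 1) = (M - 1) *m horner_mx M q.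
  have -> : M - 1 = horner_mx M ('X - 1%:P) by rewrite rmorphB /= horner_mx_X horner_mx_C.
  by rewrite !mulmxE -!rmorphM mulrC.
by rewrite mulmxA comm -mulmxA M1q.
Qed.

(** The first hypothesis is the complex eigenvalue condition in real terms, for [z = al + i ga] and
    the eigenvector [a + i b]; the later spectral analysis can thus stay over [R]. *)
Lemma powers_cvg N (M : 'M[R]_N) :
  (forall (al ga : R) (a b : 'cV[R]_N), (a != 0) || (b != 0) ->
     M *m a = al *: a - ga *: b -> M *m b = ga *: a + al *: b ->
     (al = 1 /\ ga = 0) \/ al ^+ 2 + ga ^+ 2 < 1) ->
  (forall v : 'cV[R]_N,
     (M - 1%:M) *m ((M - 1%:M) *m v) = 0 -> (M - 1%:M) *m v = 0) ->
  forall u : nat -> 'cV[R]_N, (forall k, u k.+1 = M *m u k) ->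
  exists2 l : 'cV[R]_N, M *m l = l & forall i, (fun k => u k i 0) @ \oo --> l i 0.
Proof.
case: N M => [|N] M eigM kerM u uM.
  by exists 0 => [|[]//]; apply/matrixP => -[].
pose cx p q (v : 'M[R]_(p, q)) : 'M[R[i]]_(p, q) := map_mx (real_complex R) v.
pose re (v : 'cV[R[i]]_N.+1) : 'cV[R]_N.+1 := \col_i complex.Re (v i 0).
pose im (v : 'cV[R[i]]_N.+1) : 'cV[R]_N.+1 := \col_i complex.Im (v i 0).
have reM (L : 'M[R]_N.+1) v : re (cx _ _ L *m v) = L *m re v.
  apply/colP => i; rewrite !mxE raddf_sum; apply: eq_bigr => j _ /=.
  by rewrite !mxE; case: (v j 0) => x y /=; rewrite mul0r subr0.
have imM (L : 'M[R]_N.+1) v : im (cx _ _ L *m v) = L *m im v.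
  apply/colP => i; rewrite !mxE raddf_sum; apply: eq_bigr => j _ /=.
  by rewrite !mxE; case: (v j 0) => x y /=; rewrite mul0r addr0.
have reim0 v : re v = 0 -> im v = 0 -> v = 0.
  move=> /colP rv /colP iv; apply/colP => i; move: (rv i) (iv i); rewrite !mxE.
  by case: (v i 0) => x y /= -> ->.
have cx1 : cx _ _ M - 1 = cx _ _ (M - 1%:M).
  by rewrite /cx map_mxB map_scalar_mx rmorph1.
have [||l' l'E cvl'] := @complex_powers_cvg N (cx _ _ M) _ _ (cx _ _ (u 0%N)).
- move=> [al ga] v v0 vE.
  have [||| [-> ->]|alga] := eigM al ga (re v) (im v).
  + apply: contraNT v0; rewrite negb_or !negbK => /andP[/eqP rv /eqP iv].
    by apply/eqP/reim0.
  + rewrite -reM vE; apply/colP => i; rewrite !mxE; by case: (v i 0) => x y.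
  + rewrite -imM vE; apply/colP => i; rewrite !mxE; case: (v i 0) => x y /=.
    by rewrite addrC.
  + by left.
  + right; rewrite /= -sqrtr1 ltr_sqrt //.
- rewrite cx1 => v v0; apply: reim0; rewrite ?reM ?imM; apply: kerM.
    by rewrite -!reM v0; apply/colP => i; rewrite !mxE.
  by rewrite -!imM v0; apply/colP => i; rewrite !mxE.
exists (re l') => [|i]; first by rewrite -reM l'E.
have uE k : cx _ _ M ^+ k *m cx _ _ (u 0%N) = cx _ _ (u k).
  elim: k => [|k IH]; first by rewrite mul1mx.
  by rewrite exprS -mulmxA IH uM /cx map_mxM.
apply/cvgrPdist_le => e e0.
have /cvgr0Pnorm_le/(_ _ e0) := cvl' i.
apply: filterS => k; rewrite uE => /(le_trans (ler_norm _)); apply: le_trans.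
apply: le_trans (Re_le_normc _); rewrite distrC !mxE.
by case: (l' i 0) => x y.
Qed.

End Powers.

(** * Inverses of principal blocks *)

Section BlockInverse.
Context {R : realType} (n : nat).

Definition block_incl (w : {set 'I_n}) : 'M[R]_(n, #|w|) :=
  colsub (enum_val (A := mem w)) 1%:M.

(** The inverse of a principal block, padded with zeros. When that block is definite and [S] is
    symmetric, [block_inv S w *m S] is the [S]-orthogonal projector onto vectors supported on
    [w]. *)
Definition block_inv (S : 'M[R]_n) (w : {set 'I_n}) : 'M[R]_n :=
  block_incl w *m invmx ((block_incl w)^T *m S *m block_incl w) *m (block_incl w)^T.

Lemma block_inclTE w (r : 'cV[R]_n) i : ((block_incl w)^T *m r) i 0 = r (enum_val i) 0.
Proof.
rewrite mxE (bigD1 (enum_val i)) //= !mxE eqxx mul1r big1 ?addr0 // => j /negPf jE.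
by rewrite !mxE jE mul0r.
Qed.

Lemma block_inclE (w : {set 'I_n}) (e : 'cV[R]_#|w|) l : l \notin w -> (block_incl w *m e) l 0 = 0.
Proof.
move=> lw; rewrite mxE big1 // => i _; rewrite !mxE.
by case: eqP => [lE|]; [rewrite lE enum_valP in lw | rewrite mul0r].
Qed.

Lemma block_inclK (w : {set 'I_n}) (r : 'cV[R]_n) : (forall l, l \notin w -> r l 0 = 0) ->
  block_incl w *m ((block_incl w)^T *m r) = r.
Proof.
move=> r0; apply/colP => l; have [lw|lw] := boolP (l \in w); last first.
  by rewrite block_inclE // r0.
rewrite mxE (bigD1 (enum_rank_in lw l)) //= block_inclTE enum_rankK_in //.
rewrite !mxE enum_rankK_in // eqxx mul1r big1 ?addr0 // => i il.
rewrite !mxE; case: eqP => [lE|]; last by rewrite mul0r.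
by case/eqP: il; apply: enum_val_inj; rewrite enum_rankK_in.
Qed.

Lemma pd_unitmx k (K : 'M[R]_k) : pd_mx K -> K \in unitmx.
Proof.
move=> [_ Kpos]; rewrite unitmxE unitfE; apply/det0P => -[v v0 vK].
have := Kpos v^T; rewrite -(inj_eq trmx_inj) trmxK trmx0 => /(_ v0).
by rewrite /dotv trmxK mulmxA vK mul0mx mxE ltxx.
Qed.

Lemma dotv_pd_eq0 k (K : 'M[R]_k) v : pd_mx K -> dotv v (K *m v) = 0 -> v = 0.
Proof. by move=> [_ Kpos] v0; apply/eqP; apply: contra_eqT v0 => /Kpos/gt_eqF->. Qed.

Variables (S : 'M[R]_n) (w : {set 'I_n}).
Let E := block_incl w.
Let K := E^T *m S *m E.
Hypothesis pdK : pd_mx K.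
Let KV : K \in unitmx := pd_unitmx pdK.

Lemma block_inv_sym : (block_inv S w)^T = block_inv S w.
Proof. by rewrite /block_inv !trmx_mul trmxK trmx_inv -/E -/K pdK.1 mulmxA. Qed.

Lemma block_invE (u : 'cV[R]_n) : block_inv S w *m u = E *m (invmx K *m (E^T *m u)).
Proof. by rewrite /block_inv -/E -/K -!mulmxA. Qed.

Lemma block_invSK (d : 'cV[R]_n) :
  (forall l, l \notin w -> d l 0 = 0) -> block_inv S w *m (S *m d) = d.
Proof.
move=> dw; rewrite -{1}(block_inclK dw) block_invE -/E.
have -> : E^T *m (S *m (E *m (E^T *m d))) = K *m (E^T *m d) by rewrite /K !mulmxA.
by rewrite mulKmx // block_inclK.
Qed.

Lemma block_inv_supp (u : 'cV[R]_n) l : l \notin w -> (block_inv S w *m u) l 0 = 0.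
Proof. by move=> lw; rewrite block_invE block_inclE. Qed.

Lemma block_invSinv : block_inv S w *m S *m block_inv S w = block_inv S w.
Proof.
apply/matrixP => i j.
have /(congr1 (fun v : 'cV_n => v i 0)) := @block_invSK (block_inv S w *m delta_mx j 0)
  (fun l => @block_inv_supp _ l).
by rewrite !mulmxA -!colE ![col _ _ _ _]mxE.
Qed.

Lemma block_inv_eq0 r : dotv r (block_inv S w *m r) = 0 ->
  block_inv S w *m r = 0 /\ forall l, l \in w -> r l 0 = 0.
Proof.
rewrite block_invE; set t := invmx K *m _ => r0.
have Kt : K *m t = E^T *m r by rewrite mulKVmx.
have t0 : t = 0 by apply: (dotv_pd_eq0 pdK); rewrite Kt -dotv_mulmxl dotvC.
rewrite t0 mulmx0; split => // l lw.
have := block_inclTE r (enum_rank_in lw l); rewrite enum_rankK_in // => <-.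
by rewrite -/E -Kt t0 mulmx0 mxE.
Qed.

End BlockInverse.

Lemma block_gram (R : realType) m n (H : 'M[R]_n) (A : 'M[R]_(m, n)) beta (w : {set 'I_n}) :
  (block_incl w)^T *m (H + beta *: (A^T *m A)) *m block_incl w =
  subblock H w w + beta *: ((colblock A w)^T *m colblock A w).
Proof.
have colE k (M : 'M[R]_(k, n)) : M *m block_incl w = colsub (enum_val (A := mem w)) M.
  by rewrite /block_incl mulmx_colsub mulmx1.
have rowE k (M : 'M[R]_(n, k)) : (block_incl w)^T *m M = rowsub (enum_val (A := mem w)) M.
  by apply: trmx_inj; rewrite trmx_mul trmxK colE trmx_mxsub.
rewrite mulmxDr mulmxDl -scalemxAr -scalemxAl; congr (_ + _ *: _).
  by rewrite -mulmxA colE rowE; apply/matrixP => i j; rewrite !mxE.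
by rewrite -!mulmxA colE mulmxA rowE /colblock trmx_mxsub.
Qed.

(** * The expected iteration *)

Lemma psd_form_eq0 (R : realType) n (M : 'M[R]_n) v :
  psd_mx M -> dotv v (M *m v) = 0 -> M *m v = 0.
Proof.
move=> [Mt Mge0] v0; apply: dotv_eq0; set u := M *m v.
pose d := dotv u (M *m u); have d0 : 0 <= d by exact: Mge0.
have vMu : dotv v (M *m u) = dotv u u by rewrite -{1}Mt -dotv_mulmxl.
(* Along [u] the form is a quadratic in [t] without constant term; the [+ 1] allows [d = 0], and the
   value is still negative unless [u = 0]. *)
pose t := - (dotv u u / (d + 1)).
have d1 : 0 < d + 1 by rewrite ltr_wpDl.
have := Mge0 (v + t *: u).
rewrite mulmxDr -scalemxAr !dotvL v0 vMu -/u -/d add0r.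
have -> : t * dotv u u + (t * dotv u u + t * (t * d)) = - (dotv u u ^+ 2 * (d + 2) / (d + 1) ^+ 2).
  by rewrite /t; field; rewrite gt_eqF.
rewrite oppr_ge0 pmulr_lle0 ?invr_gt0 ?exprn_gt0 // pmulr_lle0 ?ltr_wpDl //.
by move=> uu; apply/eqP; rewrite -sqrf_eq0 eq_le uu sqr_ge0.
Qed.

(* An eigenvalue [z = al + i ga] of the expected iteration, with eigenvector [(xi, eta)], satisfies
   [(1 - z)^2 w = (1 - z) (h + a) - z a] where [w = xi* Q^-1 xi], [h = xi* H xi] and
   [a = beta |A xi|^2]; [k1] and [k2] are the real and imaginary parts of [(A xi)* eta]. *)
Lemma eigenvalue_modulus_lt1 (R : realType) (al ga w h a k1 k2 : R) :
  0 < w -> 0 <= h -> 0 <= a -> h + a < 4 / 3 * w -> (al != 1) || (ga != 0) ->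
  k1 = h + a - (1 - al) * w -> k2 = ga * w ->
  (1 - al) * k1 + ga * k2 = al * a -> (1 - al) * k2 - ga * k1 = ga * a ->
  al ^+ 2 + ga ^+ 2 < 1.
Proof.
move=> w0 h0 a0 haw alga -> -> e1 e2.
have [ga0|ga0] := eqVneq ga 0.
  rewrite ga0 eqxx orbF in alga; rewrite ga0 expr0n /= addr0 in e1 e2 *.
  have e : (1 - al) ^+ 2 * w = (1 - al) * h + (1 - 2 * al) * a by move: e1; nra.
  have al_lt1 : al < 1.
    rewrite lt_neqAle alga leNgt; apply/negP => al1.
    have : 0 < (1 - al) ^+ 2 * w by rewrite mulr_gt0 // exprn_even_gt0 //= subr_eq0 eq_sym.
    have := mulr_ge0 h0 (ltW (_ : 0 < al - 1)); rewrite subr_gt0 => /(_ al1).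
    have := mulr_ge0 a0 (_ : 0 <= 2 * al - 1); lra.
  (* As [- al * h >= 0], the relation [e] gives [(1 - al)^2 w <= (1 - 2 al) (h + a)]. But [(1 -
     al)^2 - 4/3 (1 - 2 al) = (1 - 3 al) (- 1 - al) / 3] is nonnegative when [al <= -1]. *)
  have al_gtN1 : -1 < al.
    rewrite ltNge; apply/negP => alN1.
    have : (1 - 2 * al) * (h + a) < (1 - 2 * al) * (4 / 3 * w).
      by rewrite ltr_pM2l //; lra.
    have := mulr_ge0 h0 (_ : 0 <= - al); have : 0 <= w * ((1 - 3 * al) * (- 1 - al)).
      by apply: mulr_ge0; [exact: ltW | apply: mulr_ge0; lra].
    by nra.
  nra.
have e3 : 2 * (1 - al) * w = h + 2 * a.
  by apply: (mulfI ga0); move: e2; lra.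
have ha0 : 0 < h + a.
  rewrite lt_def addr_ge0 // andbT; apply/eqP => ha.
  have h00 : h = 0 by lra.
  have a00 : a = 0 by lra.
  have al1 : al = 1.
    have : (1 - al) * w = 0 by lra.
    by move/eqP; rewrite mulf_eq0 (gt_eqF w0) orbF subr_eq0 => /eqP.
  move: e1; rewrite al1 h00 a00 subrr !mul0r mulr0 add0r => /eqP.
  by rewrite mulrA !mulf_eq0 (gt_eqF w0) orbF orbb (negPf ga0).
have : (al ^+ 2 + ga ^+ 2) * w = w - (h + a) by move: e1 e3; nra.
move=> e; rewrite -(ltr_pM2r w0) e mul1r; lra.
Qed.

Section ExpectedIteration.
Context {R : realType} (m n : nat).
Variables (H : 'M[R]_n) (A : 'M[R]_(m, n)) (beta : R) (Q : 'M[R]_n).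
Let S := H + beta *: (A^T *m A).

(* The map [(x - xs, y - ys) |-> (x' - xs, y' - ys)] of one iteration, for a KKT point [(xs, ys)],
   when the sweep is [x' - xs = (x - xs) - Q' (S (x - xs) - A^T (y - ys))]. *)
Definition iter_mx (Q' : 'M[R]_n) : 'M[R]_(n + m) :=
  block_mx (1%:M - Q' *m S) (Q' *m A^T)
           (- beta *: (A *m (1%:M - Q' *m S))) (1%:M - beta *: (A *m Q' *m A^T)).

Lemma iter_mxE Q' (x : 'cV[R]_n) (y : 'cV[R]_m) (x' := x - Q' *m (S *m x - A^T *m y)) :
  iter_mx Q' *m col_mx x y = col_mx x' (y - beta *: (A *m x')).
Proof.
have x'E : x' = (1%:M - Q' *m S) *m x + Q' *m A^T *m y.
  by rewrite /x' mulmxBr mulmxBl mul1mx !mulmxA opprB addrA addrAC.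
rewrite /iter_mx mul_block_col; congr col_mx; first by rewrite x'E.
rewrite mulmxBl mul1mx -!scalemxAl scaleNr x'E (mulmxDr A (_ *m x)) scalerDr opprD addrCA.
by rewrite !mulmxA.
Qed.

Hypothesis psdH : psd_mx H.
Hypothesis beta0 : 0 < beta.

Lemma dotv_S u v : dotv u (S *m v) = dotv u (H *m v) + beta * dotv (A *m u) (A *m v).
Proof. by rewrite mulmxDl -scalemxAl dotvDr dotvZr -mulmxA -dotv_mulmxl. Qed.

Lemma psd_S : psd_mx S.
Proof.
split=> [|v].
  by rewrite /S linearD /= linearZ /= trmx_mul trmxK psdH.1.
by rewrite dotv_S addr_ge0 ?psdH.2 // mulr_ge0 ?dotv_ge0 ?ltW.
Qed.

Hypothesis pdQ : pd_mx Q.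
Hypothesis Q43 : forall v, 0 < dotv v (S *m v) ->
  dotv (S *m v) (Q *m (S *m v)) < 4 / 3 * dotv v (S *m v).

Lemma dotv_symQ u v : dotv (Q *m u) v = dotv u (Q *m v).
Proof. by rewrite dotv_mulmxl pdQ.1. Qed.

(** This turns [S Q S < 4/3 S] into [S < 4/3 Q^-1]: the form of [Q] at [w - 3/4 S x] is nonnegative,
    and [- 3/2 + 9/16 * 4/3 = - 3/4]. *)
Lemma S_lt43_Qinv w : w != 0 ->
  dotv (Q *m w) (S *m (Q *m w)) < 4 / 3 * dotv w (Q *m w).
Proof.
move=> w0; set x := Q *m w; set h := dotv x _.
have W0 : 0 < dotv w x by exact: pdQ.2.
have [h0|h0] := ltP 0 h; last by apply: le_lt_trans h0 _; rewrite mulr_gt0.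
have := Q43 h0; rewrite -/h.
pose u := w - 3 / 4 *: (S *m x).
have : 0 <= dotv u (Q *m u).
  by have [->|/pdQ.2/ltW//] := eqVneq u 0; rewrite mulmx0 dotv0r.
rewrite /u mulmxBr -scalemxAr !dotvL -/x.
have -> : dotv w (Q *m (S *m x)) = h by rewrite -dotv_symQ.
have -> : dotv (S *m x) x = h by rewrite dotvC.
lra.
Qed.

Lemma iter_fixed (x : 'cV[R]_n) (y : 'cV[R]_m) : iter_mx Q *m col_mx x y = col_mx x y ->
  [/\ S *m x = A^T *m y, H *m x = A^T *m y & A *m x = 0].
Proof.
rewrite iter_mxE => /eq_col_mx[ex ey].
have Qg : Q *m (S *m x - A^T *m y) = 0.
  by move/eqP: ex; rewrite -subr_eq0 addrAC subrr sub0r oppr_eq0 => /eqP.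
have Sx : S *m x = A^T *m y.
  by apply/eqP; rewrite -subr_eq0 -[_ - _](mulKmx (pd_unitmx pdQ)) Qg mulmx0.
have Ax : A *m x = 0.
  move/eqP: ey; rewrite ex -subr_eq0 addrAC subrr sub0r oppr_eq0 scaler_eq0.
  by rewrite (gt_eqF beta0) => /eqP.
split=> //.
by rewrite -Sx mulmxDl -scalemxAl -mulmxA Ax mulmx0 scaler0 addr0.
Qed.

(** The image [(x', y')] is fixed, so [A x' = 0] and [H x' = A^T y']; hence [x'] has zero [H]-form
    and [A^T y' = 0]. As [y' = - beta A x], also [A x = 0] and [y' = 0]. Then the [Q]-form of [g],
    which is minus the product of [g] and [x'], vanishes. *)
Lemma iter_ker (z : 'cV[R]_(n + m)) : (iter_mx Q - 1%:M) *m ((iter_mx Q - 1%:M) *m z) = 0 ->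
  (iter_mx Q - 1%:M) *m z = 0.
Proof.
rewrite -[z]vsubmxK; set x := usubmx z; set y := dsubmx z.
pose g := S *m x - A^T *m y.
pose x' := - (Q *m g); pose y' := - (beta *: (A *m (x + x'))).
have zE : (iter_mx Q - 1%:M) *m col_mx x y = col_mx x' y'.
  rewrite mulmxBl mul1mx iter_mxE opp_col_mx add_col_mx.
  by congr col_mx; rewrite addrAC subrr add0r.
rewrite zE => /eqP; rewrite mulmxBl mul1mx subr_eq0 => /eqP/iter_fixed[Sx' Hx' Ax'].
have Hx'0 : H *m x' = 0.
  by apply: psd_form_eq0 => //; rewrite Hx' -dotv_mulmxl Ax' dotvC dotv0r.
have y'E : y' = - (beta *: (A *m x)) by rewrite /y' mulmxDr Ax' addr0.
have Ax : A *m x = 0.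
  apply: dotv_eq0; rewrite dotv_mulmxl.
  have : A^T *m y' = 0 by rewrite -Hx' Hx'0.
  rewrite y'E mulmxN -scalemxAr => /eqP; rewrite oppr_eq0 scaler_eq0 (gt_eqF beta0) /=.
  by move/eqP->; rewrite dotv0r.
have y'0 : y' = 0 by rewrite y'E Ax scaler0 oppr0.
suff -> : x' = 0 by rewrite y'0 col_mx0.
have [/eqP|/pdQ.2] := eqVneq g 0; first by rewrite /x' => /eqP ->; rewrite mulmx0 oppr0.
have -> : dotv g (Q *m g) = - dotv g x' by rewrite dotvNr opprK.
rewrite {1}/g dotvDl dotvNl dotv_mulmxl psd_S.1 Sx' y'0 mulmx0 dotv0r.
by rewrite dotv_mulmxl trmxK Ax' dotv0r subr0 oppr0 ltxx.
Qed.

(** For [z = al + i ga] and [x = x1 + i x2] the equations read [g = (1 - z) Q^-1 x] and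
    [(1 - z) y = beta z A x]; pairing them with [x] and [A x] gives the scalar relations of
    [eigenvalue_modulus_lt1]. *)
Lemma iter_eigen (al ga : R) (a b : 'cV[R]_(n + m)) : (a != 0) || (b != 0) ->
  iter_mx Q *m a = al *: a - ga *: b -> iter_mx Q *m b = ga *: a + al *: b ->
  (al = 1 /\ ga = 0) \/ al ^+ 2 + ga ^+ 2 < 1.
Proof.
have [/andP[/eqP -> /eqP ->]|] := boolP ((al == 1) && (ga == 0)); first by left.
rewrite negb_and => alga; rewrite -[a]vsubmxK -[b]vsubmxK.
set x1 := usubmx a; set y1 := dsubmx a; set x2 := usubmx b; set y2 := dsubmx b.
move=> ab0; rewrite !iter_mxE !scale_col_mx opp_col_mx !add_col_mx.
set g1 := S *m x1 - _; set g2 := S *m x2 - _.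
move=> /eq_col_mx[ex1 ey1] /eq_col_mx[ex2 ey2]; right.
rewrite ex1 in ey1; rewrite ex2 in ey2.
pose w1 := invmx Q *m x1; pose w2 := invmx Q *m x2.
have QV := pd_unitmx pdQ.
have x1E : x1 = Q *m w1 by rewrite mulKVmx.
have x2E : x2 = Q *m w2 by rewrite mulKVmx.
have g1E : g1 = (1 - al) *: w1 + ga *: w2.
  apply: (can_inj (mulKmx QV)); rewrite [RHS]mulmxDr -!scalemxAr -x1E -x2E.
  have -> : Q *m g1 = x1 - (al *: x1 - ga *: x2) by rewrite -ex1 subKr.
  by apply/colP => i; rewrite !mxE; ring.
have g2E : g2 = (1 - al) *: w2 - ga *: w1.
  apply: (can_inj (mulKmx QV)); rewrite [RHS]mulmxBr -!scalemxAr -x1E -x2E.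
  have -> : Q *m g2 = x2 - (ga *: x1 + al *: x2) by rewrite -ex2 subKr.
  by apply/colP => i; rewrite !mxE; ring.
have f1 : (1 - al) *: y1 + ga *: y2 = beta *: (al *: (A *m x1) - ga *: (A *m x2)).
  move/colP: ey1 => ey1; apply/colP => i; move: (ey1 i).
  by rewrite mulmxBr -!scalemxAr !mxE; lra.
have f2 : (1 - al) *: y2 - ga *: y1 = beta *: (ga *: (A *m x1) + al *: (A *m x2)).
  move/colP: ey2 => ey2; apply/colP => i; move: (ey2 i).
  by rewrite mulmxDr -!scalemxAr !mxE; lra.
(* If the primal part is zero, then [(1 - z) y = 0] with [z != 1], and the whole eigenvector would
   vanish. *)
have [/andP[/eqP x10 /eqP x20]|x0] := boolP ((x1 == 0) && (x2 == 0)).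
  have n0 : (1 - al) ^+ 2 + ga ^+ 2 != 0.
    rewrite paddr_eq0 ?sqr_ge0 // !sqrf_eq0 subr_eq0 (eq_sym 1).
    by rewrite negb_and.
  have rot0 (u v : 'cV[R]_m) : (1 - al) *: u + ga *: v = 0 ->
      (1 - al) *: v - ga *: u = 0 -> u = 0 /\ v = 0.
    move=> e1 e2; split; apply/eqP.
      have : ((1 - al) ^+ 2 + ga ^+ 2) *: u =
          (1 - al) *: ((1 - al) *: u + ga *: v) - ga *: ((1 - al) *: v - ga *: u).
        by apply/colP => i; rewrite !mxE; ring.
      by rewrite e1 e2 !scaler0 subr0 => /eqP; rewrite scaler_eq0 (negPf n0).
    have : ((1 - al) ^+ 2 + ga ^+ 2) *: v =
        ga *: ((1 - al) *: u + ga *: v) + (1 - al) *: ((1 - al) *: v - ga *: u).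
      by apply/colP => i; rewrite !mxE; ring.
    by rewrite e1 e2 !scaler0 addr0 => /eqP; rewrite scaler_eq0 (negPf n0).
  have [||y10 y20] := rot0 y1 y2.
  - by rewrite f1 x10 x20 !mulmx0 !scaler0 subr0 scaler0.
  - by rewrite f2 x10 x20 !mulmx0 !scaler0 addr0 scaler0.
  by move: ab0; rewrite x10 x20 y10 y20 col_mx0 eqxx.
pose w := dotv x1 w1 + dotv x2 w2.
pose h := dotv x1 (H *m x1) + dotv x2 (H *m x2).
pose c := beta * (dotv (A *m x1) (A *m x1) + dotv (A *m x2) (A *m x2)).
pose k1 := dotv (A *m x1) y1 + dotv (A *m x2) y2.
pose k2 := dotv (A *m x1) y2 - dotv (A *m x2) y1.
have x12 : dotv x1 w2 = dotv x2 w1 by rewrite x1E dotv_symQ -x2E dotvC.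
have w_gt0 x u : x = Q *m u -> x != 0 -> 0 < dotv x u.
  move=> ->; have [->|u0 _] := eqVneq u 0; first by rewrite mulmx0 eqxx.
  by rewrite dotv_symQ; exact: pdQ.2.
have lt43 x u : x = Q *m u -> x != 0 -> dotv x (S *m x) < 4 / 3 * dotv x u.
  move=> ->; have [->|u0 _] := eqVneq u 0; first by rewrite mulmx0 eqxx.
  by rewrite (dotv_symQ u u); exact: S_lt43_Qinv.
have le43 x u : x = Q *m u -> dotv x (S *m x) <= 4 / 3 * dotv x u.
  move=> xE; have [->|/(lt43 _ _ xE)/ltW//] := eqVneq x 0.
  by rewrite mulmx0 dotv0r (dotvC 0) dotv0r mulr0.
have ww : 0 <= dotv x1 w1 /\ 0 <= dotv x2 w2.
  have ge0 x u : x = Q *m u -> 0 <= dotv x u.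
    move=> xE; have [->|/(w_gt0 _ _ xE)/ltW//] := eqVneq x 0.
    by rewrite dotvC dotv0r.
  by split; exact: ge0.
have {}x0 : (x1 != 0) || (x2 != 0) by rewrite -negb_and.
have dotv_xg u v yv : dotv u (S *m v - A^T *m yv) =
    dotv u (H *m v) + beta * dotv (A *m u) (A *m v) - dotv (A *m u) yv.
  by rewrite dotvDr dotvNr dotv_S -dotv_mulmxl.
apply: (@eigenvalue_modulus_lt1 R al ga w h c k1 k2) => //.
- by have := ww; have /orP[/(w_gt0 _ _ x1E)|/(w_gt0 _ _ x2E)] := x0; rewrite /w; lra.
- by rewrite /h addr_ge0 ?psdH.2.
- by rewrite /c mulr_ge0 ?addr_ge0 ?dotv_ge0 ?ltW.
- have -> : h + c = dotv x1 (S *m x1) + dotv x2 (S *m x2).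
    by rewrite !dotv_S /h /c; ring.
  by have /orP[/(lt43 _ _ x1E)|/(lt43 _ _ x2E)] := x0;
    have := le43 _ _ x1E; have := le43 _ _ x2E; rewrite /w; lra.
- have : dotv x1 g1 + dotv x2 g2 = (1 - al) * w.
    by rewrite g1E g2E !dotvL x12 /w; ring.
  by rewrite !dotv_xg /k1 /h /c; lra.
- have : dotv x2 g1 - dotv x1 g2 = ga * w.
    by rewrite g1E g2E !dotvL x12 /w; ring.
  rewrite !dotv_xg /k2.
  have -> : dotv x2 (H *m x1) = dotv x1 (H *m x2) by rewrite dotvC dotv_mulmxl psdH.1.
  by rewrite (dotvC (A *m x2) (A *m x1)); lra.
- transitivity (dotv (A *m x1) ((1 - al) *: y1 + ga *: y2)
             + dotv (A *m x2) ((1 - al) *: y2 - ga *: y1)).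
    by rewrite !dotvL /k1 /k2; ring.
  by rewrite f1 f2 !dotvL (dotvC (A *m x2) (A *m x1)) /c; ring.
- transitivity (dotv (A *m x1) ((1 - al) *: y2 - ga *: y1)
             - dotv (A *m x2) ((1 - al) *: y1 + ga *: y2)).
    by rewrite !dotvL /k1 /k2; ring.
  by rewrite f1 f2 !dotvL (dotvC (A *m x2) (A *m x1)) /c; ring.
Qed.

End ExpectedIteration.

(** * Summation over updating orders *)

Section FfunCons.
Variables (G : finType) (k : nat).

Definition fcons (g : G) (f : {ffun 'I_k -> G}) : {ffun 'I_k.+1 -> G} :=
  [ffun i => if unlift ord0 i is Some j then f j else g].

Lemma fcons0 g f : fcons g f ord0 = g.
Proof. by rewrite ffunE unlift_none. Qed.

Lemma fconsS g f j : fcons g f (lift ord0 j) = f j.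
Proof. by rewrite ffunE liftK. Qed.

Lemma codom_fcons g f : codom (fcons g f) = g :: codom f.
Proof.
rewrite /codom /image_mem enum_ordSl /= fcons0 -map_comp; congr cons.
by apply: eq_map => j; rewrite /= fconsS.
Qed.

Lemma big_fcons (V : nmodType) (P : pred {ffun 'I_k.+1 -> G}) (F : {ffun 'I_k.+1 -> G} -> V) :
  \sum_(f | P f) F f = \sum_g \sum_(f | P (fcons g f)) F (fcons g f).
Proof.
rewrite (pair_big_dep predT (fun g f => P (fcons g f))) /=.
rewrite (reindex (fun p : G * {ffun 'I_k -> G} => fcons p.1 p.2)) //=.
exists (fun f => (f ord0, [ffun j => f (lift ord0 j)])) => [[g f]|f] _ /=.
  by rewrite fcons0; congr pair; apply/ffunP => j; rewrite ffunE fconsS.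
apply/ffunP => i; rewrite ffunE; case: unliftP => [j|] -> //.
by rewrite ffunE.
Qed.

Lemma forall_fcons g f (P : pred G) :
  [forall i, P (fcons g f i)] = P g && [forall i, P (f i)].
Proof.
apply/forallP/andP => [Pgf|[Pg /forallP Pf] i].
  split; first by have := Pgf ord0; rewrite fcons0.
  by apply/forallP => j; have := Pgf (lift ord0 j); rewrite fconsS.
by rewrite ffunE; case: unliftP.
Qed.

End FfunCons.

Section SumTrajectories.
Context {R : realType} (G : finType) (D : {set G}) (N : nat) (M : G -> 'M[R]_N).

Definition traj (l : seq G) (z : 'cV[R]_N) := foldl (fun z g => M g *m z) z l.

(** Independence in algebraic form: a power of the sum over [D] expands into the products along all
    sequences of draws. *)
Lemma sum_traj k z :
  \sum_(f : {ffun 'I_k -> G} | [forall i, f i \in D]) traj (codom f) z =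
  iter k (mulmx (\sum_(g in D) M g)) z.
Proof.
elim: k z => [|k IH] z /=.
  rewrite (big_pred1 (ffun0 (card_ord 0))) => [|f].
    by rewrite /codom /image_mem enum_ord0.
  apply/idP/idP => _; first by apply/eqP/ffunP => -[].
  by apply/forallP => -[].
rewrite -iterS iterSr big_fcons mulmx_suml.
have iter_sum (I : finType) (P : pred I) (F : I -> 'cV[R]_N) L :
    iter k (mulmx L) (\sum_(i | P i) F i) = \sum_(i | P i) iter k (mulmx L) (F i).
  by elim: (k) => //= j ->; rewrite mulmx_sumr.
rewrite iter_sum [RHS]big_mkcond; apply: eq_bigr => g _.
rewrite (eq_bigl (fun f : {ffun 'I_k -> G} => (g \in D) && [forall i, f i \in D])); last first.
  by move=> f; exact: (forall_fcons g f (fun x => x \in D)).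
case: ifP => gD; last by rewrite big_pred0.
by rewrite -IH; apply: eq_bigr => f _; rewrite codom_fcons.
Qed.

End SumTrajectories.

Section SumSweeps.
Context {R : realType} (n s : nat).
Variables (S : 'M[R]_n) (B : {set 'I_n} -> 'M[R]_n).
Hypothesis psdS : psd_mx S.
Hypothesis trB : forall w : {set 'I_n}, #|w| = s -> (B w)^T = B w.

(** The sweep matrix of one order. The head of the list is updated first, whereas [Gsum] removes the
    block updated last; [Gsum_first] reconciles the two by transposition. *)
Fixpoint sweep_inv (l : seq {set 'I_n}) : 'M[R]_n :=
  if l is w :: l' then sweep_inv l' + B w - sweep_inv l' *m S *m B w else 0.

Definition Gamma_block k (U : {set 'I_n}) (f : {ffun 'I_k -> {set 'I_n}}) :=
  [&& [forall i, isblock s U (f i)],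
      [forall i, forall j, (i != j) ==> [disjoint f i & f j]] &
      [forall l, (l \in U) ==> [exists i, l \in f i]]].

Lemma Gamma_block_fcons k U w (f : {ffun 'I_k -> {set 'I_n}}) :
  Gamma_block U (fcons w f) = isblock s U w && Gamma_block (U :\: w) f.
Proof.
rewrite /Gamma_block (forall_fcons w f (isblock s U)).
case Uw: (isblock s U w) => //=; apply/and3P/and3P.
  move=> [/forallP fU /forallP fd /forallP fc]; split.
  - apply/forallP => i; move: (fU i); rewrite /isblock subsetD => /andP[-> ->].
    have /forallP/(_ ord0) := fd (lift ord0 i).
    by rewrite fcons0 fconsS eq_sym neq_lift => /= ->.
  - apply/forallP => i; apply/forallP => j; have /forallP/(_ (lift ord0 j)) := fd (lift ord0 i).
    by rewrite !fconsS (inj_eq lift_inj).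
  - apply/forallP => l; apply/implyP; rewrite finset.inE => /andP[lw lU].
    have /implyP/(_ lU)/existsP[i1] := fc l; rewrite ffunE.
    by case: unliftP => [j|] _ lf; [apply/existsP; exists j | rewrite lf in lw].
move=> [/forallP fU /forallP fd /forallP fc]; split.
- by apply/forallP => i; move: (fU i); rewrite /isblock subsetD => /andP[/andP[-> _] ->].
- have fw i : [disjoint f i & w]%B by move: (fU i); rewrite /isblock subsetD => /andP[/andP[]].
  apply/forallP => i; apply/forallP => j; apply/implyP; rewrite !ffunE.
  case: unliftP => [i'|] ->; case: unliftP => [j'|] -> //.
  + by rewrite (inj_eq lift_inj) => ij; have /forallP/(_ j')/implyP := fd i'; apply.
  + by rewrite disjoint_sym => _; exact: fw.
- apply/forallP => l; apply/implyP => lU; apply/existsP.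
  have [lw|lw] := boolP (l \in w); first by exists ord0; rewrite fcons0.
  have lUw : l \in U :\: w by rewrite finset.inE lw.
  have /implyP/(_ lUw)/existsP[i1 lf] := fc l.
  by exists (lift ord0 i1); rewrite fconsS.
Qed.

Lemma Gamma_block0 U (f : {ffun 'I_0 -> {set 'I_n}}) : Gamma_block U f = (U == finset.set0).
Proof.
apply/and3P/eqP => [[_ _ /forallP fc]|->].
  by apply/setP => l; rewrite finset.inE; apply/negP => lU;
    have /implyP/(_ lU)/existsP[[]] := fc l.
by split; apply/forallP => -[] // l lt; rewrite finset.inE.
Qed.

Lemma card_Gamma_block k U :
  (\sum_(f : {ffun 'I_k -> {set 'I_n}} | Gamma_block U f) 1)%N = Gcount s k U.
Proof.
elim: k U => [|k IH] U /=.
  under eq_bigl do rewrite Gamma_block0.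
  by case: (U == _); rewrite ?big_pred0_eq // sum1_card card_ffun card_ord expn0.
rewrite big_fcons [RHS]big_mkcond; apply: eq_bigr => w _.
under eq_bigl do rewrite Gamma_block_fcons.
by case: ifP => _; rewrite /= ?big_pred0_eq ?IH.
Qed.

Lemma Gsum_first k U : Gsum s S B k.+1 U = \sum_(w | isblock s U w)
  (Gsum s S B k (U :\: w) + (Gcount s k (U :\: w))%:R *: B w
   - Gsum s S B k (U :\: w) *m S *m B w).
Proof.
rewrite -(Gsum_sym psdS trB) /= linear_sum; apply: eq_bigr => w /andP[_ /eqP ws].
rewrite linearB linearD linearZ /= !trmx_mul (Gsum_sym psdS trB) trB // psdS.1.
by rewrite mulmxA.
Qed.

Lemma sum_sweep_inv k U :
  \sum_(f : {ffun 'I_k -> {set 'I_n}} | Gamma_block U f) sweep_inv (codom f) =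
  Gsum s S B k U.
Proof.
elim: k U => [|k IH] U.
  by rewrite big1 // => f _; rewrite /codom /image_mem enum_ord0.
rewrite Gsum_first big_fcons [RHS]big_mkcond; apply: eq_bigr => w _.
under eq_bigl do rewrite Gamma_block_fcons.
case: ifP => _; rewrite /= ?big_pred0_eq //.
under eq_bigr do rewrite codom_fcons /=.
rewrite sumrB big_split /= -!mulmx_suml IH -card_Gamma_block natr_sum scaler_suml.
by under [X in _ = _ + X - _]eq_bigr do rewrite scale1r.
Qed.

End SumSweeps.

Lemma Gamma_RAC_block n p s (f : {ffun 'I_p -> {set 'I_n}}) :
  (f \in Gamma_RAC n p s) = Gamma_block s [set: 'I_n] f.
Proof.
rewrite finset.inE; congr [&& _, _ & _].
  by apply: eq_forallb => i; rewrite /isblock finset.subsetT.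
by apply: eq_forallb => l; rewrite finset.inE.
Qed.

(** * One iteration of RAC-ADMM *)

Section Step.
Context {R : realType} (m n p s : nat).
Variables (H : 'M[R]_n) (c : 'cV[R]_n) (A : 'M[R]_(m, n)) (b : 'cV[R]_m) (beta : R).
Let S := H + beta *: (A^T *m A).
Let B := block_inv S.
Hypothesis psdH : psd_mx H.
Hypothesis beta0 : 0 < beta.
Hypothesis pdS : forall w : {set 'I_n}, #|w| = s ->
  pd_mx ((block_incl w)^T *m S *m block_incl w).

Lemma aug_lagrangianD u d y : aug_lagrangian H c A b beta (u + d) y =
  aug_lagrangian H c A b beta u y
  + dotv d (S *m u - (A^T *m y + beta *: (A^T *m b) - c)) + 2^-1 * dotv d (S *m d).
Proof.
have AT v : dotv d (A^T *m v) = dotv (A *m d) v by rewrite dotv_mulmxl.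
have dHu : dotv d (H *m u) = dotv u (H *m d) by rewrite -{1}psdH.1 -dotv_mulmxl dotvC.
rewrite /aug_lagrangian mulmxDr.
have -> : A *m (u + d) - b = (A *m u - b) + A *m d by rewrite mulmxDr addrAC.
have -> : S *m u - (A^T *m y + beta *: (A^T *m b) - c) =
    H *m u + beta *: (A^T *m (A *m u - b)) - A^T *m y + c.
  rewrite mulmxDl -scalemxAl -mulmxA mulmxBr scalerBr.
  by apply/colP => i; rewrite !mxE; ring.
rewrite (dotv_S H A beta) !dotvL !AT !dotvL dHu (dotvC c d) (dotvC y (A *m d)).
rewrite (dotvC (A *m d) (A *m u)) (dotvC (A *m d) b).
by field.
Qed.

(** Moving from [v1] by [- B w g], with [g] the gradient there, lowers the value by half the form of
    [B w] at [g]. Minimality forces [B w g = 0], and [B w S] fixes [v1 - v]. *)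
Lemma block_min (w : {set 'I_n}) (v v1 : 'cV[R]_n) y : #|w| = s ->
  (forall l, l \notin w -> v1 l 0 = v l 0) ->
  (forall u : 'cV[R]_n, (forall l, l \notin w -> u l 0 = v1 l 0) ->
     aug_lagrangian H c A b beta v1 y <= aug_lagrangian H c A b beta u y) ->
  v1 = v - B w *m (S *m v - (A^T *m y + beta *: (A^T *m b) - c)).
Proof.
move=> ws vw min; set r := A^T *m y + _ - c; pose g := S *m v1 - r.
have pdw := pdS ws.
have Bg : B w *m g = 0.
  apply: (block_inv_eq0 pdw _).1.
  have Bg0 : 0 <= dotv (B w *m g) (S *m (B w *m g)) by exact: (psd_S _ psdH beta0).2.
  have BgS : dotv (B w *m g) (S *m (B w *m g)) = dotv g (B w *m g).
    by rewrite dotv_mulmxl (block_inv_sym pdw) (block_invSK pdw) // => l; exact: block_inv_supp.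
  have := min (v1 - B w *m g) _; rewrite aug_lagrangianD -/r -/g mulmxN !dotvNl dotvNr opprK.
  rewrite BgS (dotvC (B w *m g) g) => le.
  apply/eqP; rewrite eq_le -{2}BgS Bg0 andbT.
  have : aug_lagrangian H c A b beta v1 y <= aug_lagrangian H c A b beta v1 y
           - dotv g (B w *m g) + 2^-1 * dotv g (B w *m g).
    apply: le => l lw; rewrite mxE [X in _ + X]mxE.
    by rewrite (block_inv_supp S g lw) oppr0 addr0.
  lra.
pose d := v1 - v.
have BSd : B w *m (S *m d) = d.
  by apply: block_invSK => // l lw; rewrite !mxE vw // subrr.
have -> : S *m v - r = g - S *m d 
  by rewrite /g /d [in RHS]mulmxBr; apply/colP => i; rewrite !mxE; ring.
by rewrite mulmxBr Bg BSd sub0r opprK /d; apply/colP => i; rewrite !mxE; ring.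
Qed.

Lemma sweep_inv_iter (l : seq {set 'I_n}) (st : nat -> 'cV[R]_n) r :
  (forall i, (i < size l)%N ->
     st i.+1 = st i - B (nth finset.set0 l i) *m (S *m st i - r)) ->
  st (size l) = st 0%N - sweep_inv S B l *m (S *m st 0%N - r).
Proof.
elim: l st => [|w l IH] st stE; first by rewrite mul0mx subr0.
rewrite /= (IH (fun i => st i.+1)); last by move=> i il; exact: (stE i.+1).
rewrite (stE 0%N) //=; set g := S *m st 0%N - r.
move: (sweep_inv S B l) (B w) => L b0.
have -> : S *m (st 0%N - b0 *m g) - r = g - S *m (b0 *m g).
  by rewrite mulmxBr addrAC.
rewrite (mulmxBr L) (mulmxBl (L + b0)) (mulmxDl L) -(mulmxA _ b0) -(mulmxA L S).
have abel (z t u v : 'cV[R]_n) : z - t - (u - v) = z - (u + t - v).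
  by apply/colP => i; rewrite !mxE; ring.
exact: abel.
Qed.

Lemma rac_admm_step_iter (sigma : {ffun 'I_p -> {set 'I_n}}) xs ys x y x' y' :
  sigma \in Gamma_RAC n p s -> is_KKT H c A b xs ys ->
  rac_admm_step H c A b beta sigma x y x' y' ->
  col_mx (x' - xs) (y' - ys) =
  iter_mx H A beta (sweep_inv S B (codom sigma)) *m col_mx (x - xs) (y - ys).
Proof.
rewrite finset.inE => /and3P[/forallP sigs _ /forallP sigc] [Hxs Axs] [min y'E].
(* [st j] is the vector just before block [j] is updated, so [sweep sigma x x' i] is [st i.+1]. *)
pose st (j : nat) : 'cV[R]_n :=
  \col_l (if [exists i : 'I_p, (i < j)%N && (l \in sigma i)] then x' l 0 else x l 0).
have st0 : st 0%N = x.
  apply/colP => l; rewrite mxE; case: ifP => // /existsP[j].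
  by rewrite ltn0.
have stp : st p = x'.
  apply/colP => l; rewrite mxE; case: ifP => // /existsP[].
  by have /existsP[j lj] := sigc l; exists j; rewrite ltn_ord.
pose r := A^T *m y + beta *: (A^T *m b) - c.
have szp : size (codom sigma) = p by rewrite size_codom card_ord.
have x'E : x' = x - sweep_inv S B (codom sigma) *m (S *m x - r).
  rewrite -stp -{1}szp (@sweep_inv_iter _ _ r) ?st0 // => i0; rewrite szp => i0p.
  pose i := Ordinal i0p.
  have -> : nth finset.set0 (codom sigma) i0 = sigma i.
    by rewrite (nth_map i) ?size_enum_ord // (nth_ord_enum i i).
  apply: block_min; first exact/eqP/sigs.
    move=> l li; rewrite !mxE; congr (if _ then _ else _).
    apply/existsP/existsP => -[j /andP[ji lj]]; exists j; rewrite lj andbT.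
      rewrite ltn_neqAle -ltnS ji andbT; apply: contraNneq li => ji0.
      by rewrite (_ : i = j) //; apply: val_inj.
    by rewrite ltnS ltnW.
  by move=> u; exact: min.
have rE : S *m x - r = S *m (x - xs) - A^T *m (y - ys).
  have Sxs : S *m xs = A^T *m ys - c + beta *: (A^T *m b).
    rewrite mulmxDl -scalemxAl -mulmxA Axs; congr (_ + _).
    by apply/eqP; rewrite -subr_eq0 opprB addrA Hxs.
  rewrite !mulmxBr Sxs /r.
  by apply/colP => i; rewrite !mxE; ring.
rewrite iter_mxE -rE; congr col_mx; first by rewrite {1}x'E addrAC.
have -> : x - xs - sweep_inv S B (codom sigma) *m (S *m x - r) = x' - xs.
  by rewrite {1}x'E addrAC.
by rewrite y'E mulmxBr Axs addrAC.
Qed.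

End Step.

(** * Expectations over finitely many independent uniform draws *)

Section FiniteLaw.
Context {d : measure_display} {T : measurableType d} {R : realType}.
Variable P : probability T R.

Lemma expectation_finite (G : finType) (Y : T -> G) (f : G -> R) :
  (forall g, measurable (Y @^-1` [set g])) ->
  'E_P[fun w => f (Y w)]%E = (\sum_g (f g)%:E * P (Y @^-1` [set g]))%E.
Proof.
move=> mY; rewrite unlock.
have indic_int g : P.-integrable setT (fun w => (\1_(Y @^-1` [set g]) w)%:E).
  exact: integrable_indic.
transitivity (\int[P]_w (\sum_g (f g)%:E * (\1_(Y @^-1` [set g]) w)%:E))%E.
  apply: eq_integral => w _; rewrite (bigD1 (Y w)) //= indicE mem_set // mule1.
  rewrite big1 ?adde0 // => g gY; rewrite indicE memNset ?mule0 // => /= Yg.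
  by rewrite -Yg eqxx in gY.
rewrite integral_sum //; last by move=> g; exact: integrableZl.
apply: eq_bigr => g _; rewrite integralZl // integral_indic // setIT //.
Qed.

Lemma iid_uniform_law (G : finType) (D : {set G}) (X : nat -> T -> G) k
    (h : {ffun 'I_k -> G}) (Y := fun w => [ffun i : 'I_k => X i w]) :
  iid_uniform P D X ->
  measurable (Y @^-1` [set h]) /\
  P (Y @^-1` [set h]) =
    (if [forall i, h i \in D] then (#|D|%:R ^- k) else 0)%:E.
Proof.
move=> [XD mX PX indep].
(* [mutually_independent] takes an event for every index; the default [setT] beyond [k] never enters
   the intersection. *)
pose B (i : nat) : set G := if insub i is Some j then [set h j] else setT.
have YE : Y @^-1` [set h] = \bigcap_(i in [set` index_iota 0 k]) (X i @^-1` B i).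
  apply/seteqP; split => w /=.
    move=> Yh i /=; rewrite mem_index_iota => ik.
    by rewrite /B insubT /= -Yh ffunE.
  move=> Bw; apply/ffunP => i; rewrite ffunE.
  have := Bw i; rewrite /= mem_index_iota ltn_ord /B => /(_ isT).
  by rewrite valK.
split.
  rewrite YE; apply: fin_bigcap_measurable => // i /=.
  rewrite mem_index_iota => ik.
  by rewrite /B insubT; exact: mX.
rewrite YE indep ?iota_uniq // big_mkord.
case: ifPn => [/forallP hD|].
  rewrite (eq_bigr (fun=> ((#|D|%:R)^-1)%:E)) => [|i _].
    by rewrite prodEFin prodr_const card_ord -exprVn.
  by rewrite /B valK PX.
rewrite negb_forall => /existsP[i hi]; rewrite (bigD1 i) //= /B valK.
rewrite (_ : X i @^-1` [set h i] = set0) ?measure0 ?mul0e //.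
by apply/seteqP; split => // w /= Xh; rewrite -Xh XD in hi.
Qed.

Lemma expectation_iid_uniform (G : finType) (D : {set G}) (X : nat -> T -> G) k
    (f : {ffun 'I_k -> G} -> R) : iid_uniform P D X ->
  'E_P[fun w => f [ffun i : 'I_k => X i w]]%E =
  (#|D|%:R ^- k * \sum_(h : {ffun 'I_k -> G} | [forall i, h i \in D]) f h)%:E.
Proof.
move=> iidX; rewrite (@expectation_finite _ (fun w => [ffun i : 'I_k => X i w])).
  rewrite mulr_sumr -sumEFin [RHS]big_mkcond; apply: eq_bigr => h _.
  rewrite (iid_uniform_law h iidX).2; case: ifP => _; last by rewrite mule0.
  by rewrite -EFinM mulrC.
by move=> h; exact: (iid_uniform_law h iidX).1.
Qed.

End FiniteLaw.

(** * Convergence of the expected iterates *)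

(** Affine dependence on [Q] is what lets the average over orders pass inside [iter_mx]. *)
Lemma iter_mx_affine (R : realType) m n (H : 'M[R]_n) (A : 'M[R]_(m, n)) beta (Q : 'M[R]_n) :
  iter_mx H A beta Q = iter_mx H A beta 0 +
    col_mx 1%:M (- beta *: A) *m Q *m row_mx (- (H + beta *: (A^T *m A))) A^T.
Proof.
rewrite /iter_mx; set S := H + _.
rewrite mul_col_mx mul_col_row mul1mx add_block_mx; congr block_mx.
- by rewrite mul0mx subr0 mulmxN.
- by rewrite mul0mx add0r.
- by rewrite mul0mx subr0 mulmx1 mulmxBr mulmx1 scalerBr mulmxN -!scalemxAl mulmxA.
- by rewrite mulmx0 mul0mx scaler0 subr0 -!scalemxAl scaleNr.
Qed.

Lemma sum_iter_mx (R : realType) m n (H : 'M[R]_n) (A : 'M[R]_(m, n)) beta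
    (I : finType) (D : {set I}) (F : I -> 'M[R]_n) : (0 < #|D|)%N ->
  \sum_(i in D) iter_mx H A beta (F i) =
  #|D|%:R *: iter_mx H A beta (#|D|%:R^-1 *: \sum_(i in D) F i).
Proof.
move=> D0; under eq_bigr do rewrite iter_mx_affine.
rewrite big_split /= sumr_const -mulmx_suml -mulmx_sumr [in RHS]iter_mx_affine.
rewrite -scalemxAr -scalemxAl scalerDr scalerA divff ?scale1r ?scaler_nat //.
by rewrite pnatr_eq0 -lt0n.
Qed.

Lemma cvg_colP (R : realType) N (u : nat -> 'cV[R]_N) (l : 'cV[R]_N) :
  (forall i, (fun k => u k i 0) @ \oo --> l i 0) -> u @ \oo --> l.
Proof.
move=> ul; apply/cvg_ballP => e e0.
have : \forall k \near \oo, forall i, ball (l i 0) e (u k i 0).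
  by apply: filter_forall => i; have /cvg_ballP/(_ _ e0) := ul i.
by apply: filterS => k uk; split=> // i j; rewrite ord1.
Qed.

Theorem theorem2p2 (R : realType) (m n p s : nat)
  (H : 'M[R]_n) (c : 'cV[R]_n) (A : 'M[R]_(m, n)) (b : 'cV[R]_m) (beta : R)
  (hH : psd_mx H) (hbeta : 0 < beta)
  (hp : (0 < p)%N) (hs : (0 < s)%N) (hn : n = (p * s)%N)
  (hKKT : exists (xs : 'cV[R]_n) (ys : 'cV[R]_m), is_KKT H c A b xs ys)
  (hpd : forall w : {set 'I_n}, #|w| = s ->
     pd_mx (subblock H w w + beta *: ((colblock A w)^T *m colblock A w)))
  (d : measure_display) (T : measurableType d) (P : probability T R)
  (sigma : nat -> T -> {ffun 'I_p -> {set 'I_n}})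
  (hsigma : iid_uniform P (Gamma_RAC n p s) sigma)
  (x0 : 'cV[R]_n) (y0 : 'cV[R]_m)
  (x : nat -> T -> 'cV[R]_n) (y : nat -> T -> 'cV[R]_m)
  (hxy : is_rac_admm H c A b beta x0 y0 sigma x y) :
  exists (xs : 'cV[R]_n) (ys : 'cV[R]_m),
    is_KKT H c A b xs ys /\
    expectation_vec P (fun w => col_mx (x k w) (y k w)) @[k --> \oo]
      --> col_mx xs ys.
Proof.
have [xs [ys kkt]] := hKKT; have [hxy0 hstep] := hxy; have [sigD _ _ _] := hsigma.
pose S := H + beta *: (A^T *m A); pose B := block_inv S.
have psdS : psd_mx S by exact: psd_S.
have pdB (w : {set 'I_n}) : #|w| = s -> pd_mx ((block_incl w)^T *m S *m block_incl w).
  by move=> /hpd; rewrite -block_gram.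
have trB (w : {set 'I_n}) : #|w| = s -> (B w)^T = B w.
  by move=> /pdB; exact: block_inv_sym.
have BSB (w : {set 'I_n}) : #|w| = s -> B w *m S *m B w = B w.
  by move=> /pdB; exact: block_invSinv.
have B_eq0 (w : {set 'I_n}) (r : 'cV[R]_n) : #|w| = s -> dotv r (B w *m r) = 0 ->
    B w *m r = 0 /\ forall l, l \in w -> r l 0 = 0.
  by move=> /pdB pdw /(block_inv_eq0 pdw).
pose D := Gamma_RAC n p s; pose F sg := sweep_inv S B (codom (sg : {ffun 'I_p -> {set 'I_n}})).
(* The sample space has mass 1, hence a point, and the draw at that point lies in [D]. *)
have D0 : (0 < #|D|)%N.
  have [w0 _] : [set: T] !=set0.
    apply/set0P/eqP => T0; have := probability_setT P.
    by rewrite T0 measure0 => -[] /eqP; rewrite eq_sym oner_eq0.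
  by apply/card_gt0P; exists (sigma 0%N w0); exact: sigD.
have ND : #|D| = Gcount s p [set: 'I_n].
  by rewrite -card_Gamma_block -sum1_card; apply: eq_bigl => f; exact: Gamma_RAC_block.
have FD : \sum_(sg in D) F sg = Gsum s S B p [set: 'I_n].
  by rewrite -sum_sweep_inv //; apply: eq_bigl => f; exact: Gamma_RAC_block.
pose Q := #|D|%:R^-1 *: Gsum s S B p [set: 'I_n].
have N0 : 0 < #|D|%:R^-1 :> R by rewrite invr_gt0 ltr0n.
have Gc0 : (0 < Gcount s p [set: 'I_n])%N by rewrite -ND.
have pdQ : pd_mx Q.
  split=> [|v v0]; first by rewrite /Q linearZ /= (Gsum_sym psdS trB).
  rewrite /Q -scalemxAl dotvZr mulr_gt0 // lt_def (Gsum_bounds psdS trB BSB _ _).1 andbT.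
  apply: contra v0 => /eqP /(Gsum_eq0 psdS trB BSB B_eq0 Gc0) vU.
  by apply/eqP/colP => l; rewrite mxE vU // finset.in_setT.
have Q43 v : 0 < dotv v (S *m v) ->
    dotv (S *m v) (Q *m (S *m v)) < 4 / 3 * dotv v (S *m v).
  move=> v0; have := Gsum_lt43 psdS trB BSB Gc0 v0.
  by rewrite /Q -scalemxAl dotvZr ltr_pdivrMl ?ltr0n // -ND; lra.
pose M := iter_mx H A beta Q.
pose z := col_mx xs ys; pose e0 := col_mx x0 y0 - z.
have [|l Ml cvl] := @powers_cvg R _ M (iter_eigen hH hbeta pdQ Q43)
  (iter_ker hH hbeta pdQ) (fun k => iter k (mulmx M) e0); first by [].
have trajE k w : col_mx (x k w) (y k w) =
    z + traj (iter_mx H A beta \o F) (codom [ffun i : 'I_k => sigma i w]) e0.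
  have codomE j : codom [ffun i : 'I_j => sigma i w] = [seq sigma i w | i <- iota 0 j].
    by rewrite -val_enum_ord -map_comp; apply: eq_map => i; rewrite /= ffunE.
  rewrite codomE; elim: k => [|k IH].
    by rewrite (hxy0 w).1 (hxy0 w).2 /= addrC subrK.
  rewrite -[k.+1]addn1 iotaD map_cat /traj foldl_cat -/(traj _ _ _) /= addn1 add0n.
  have := rac_admm_step_iter hH hbeta pdB (sigD k w) kkt (hstep k w).
  rewrite -!add_col_mx -!opp_col_mx IH -/z.
  by rewrite addrAC subrr add0r => /(canRL (subrK _)) ->; rewrite addrC.
have expE k : expectation_vec P (fun w => col_mx (x k w) (y k w)) =
    z + iter k (mulmx M) e0.
  (* The constant 1 gives the normalization of the sum over draw sequences, used for the
     deterministic term [z]. *)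
  have E1 := @expectation_iid_uniform _ _ _ P _ D sigma k (fun=> 1) hsigma.
  rewrite expectation_cst in E1; case: E1 => E1.
  apply/colP => i; rewrite [LHS]mxE [RHS]mxE.
  under eq_fun do rewrite trajE mxE.
  rewrite (expectation_iid_uniform (fun h => z i 0
    + traj (iter_mx H A beta \o F) (codom h) e0 i 0) hsigma) /=.
  rewrite big_split mulrDr; congr (_ + _).
    under eq_bigr do rewrite -[z i 0]mul1r.
    by rewrite -mulr_suml mulrA -E1 mul1r.
  rewrite -summxE sum_traj sum_iter_mx // FD -/Q -/M.
  have -> : iter k (mulmx (#|D|%:R *: M)) e0 = #|D|%:R ^+ k *: iter k (mulmx M) e0.
    elim: k {E1} => [|k IH] /=; first by rewrite scale1r.
    by rewrite IH -scalemxAl -scalemxAr scalerA exprS.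
  by rewrite mxE mulrA mulVf ?mul1r // expf_neq0 // pnatr_eq0 -lt0n.
have [|Sx Hx Ax] := @iter_fixed _ _ _ H A beta Q hbeta pdQ (usubmx l) (dsubmx l).
  by rewrite vsubmxK.
exists (xs + usubmx l), (ys + dsubmx l); split.
  case: kkt => kkt1 kkt2; split; last by rewrite mulmxDr Ax addr0.
  by rewrite !mulmxDr Hx (addrAC (H *m xs)) opprD addrACA kkt1 add0r subrr.
rewrite -add_col_mx vsubmxK -/z; apply: cvg_colP => i.
under eq_fun do rewrite expE mxE; rewrite mxE.
by apply: cvgD; [exact: cvg_cst | exact: cvl].
Qed.
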